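(* There exist an absolute constant $c > 0$ and a sequence of lattices $(L_i)_{i=1}^{\infty}$ of ranks $a_i \uparrow \infty$, and for each $i$ a Minkowski basis $v_1(L_i), \dots, v_{a_i}(L_i)$ of $L_i$ and a Korkin-Zolotarev basis $u_1(L_i), \dots, u_{a_i}(L_i)$ of $L_i$, such that for all $i$ $$\|v_{a_i}(L_i)\|^2 \geq \frac{c \cdot a_i^{\frac{1}{3}}}{(\log a_i)^{\frac{2}{3}}} \max\left\{ \|u_1(L_i)\|^2, \dots, \|u_{a_i}(L_i)\|^2 \right\}.$$
   Context: A lattice is a discrete subgroup $L$ of some $\mathbb{R}^m$; its rank $n$ is the dimension of $\mathrm{span}_{\mathbb{R}}(L)$. $\|\cdot\|$ is the Euclidean norm. A basis of $L$ is a linearly independent sequence $b_1, \dots, b_n \in L$ with $\mathrm{span}_{\mathbb{Z}}(b_1, \dots, b_n) = L$. A sequence $b_1, \dots, b_i \in L$ is called primitive if it can be completed to a basis $b_1, \dots, b_n$ of $L$. A basis $b_1, \dots, b_n$ of $L$ is a Minkowski basis if, for each $i$, $b_i$ is a vector of smallest length among all vectors $b \in L$ such that $b_1, \dots, b_{i-1}, b$ is primitive. A basis $b_1, \dots, b_n$ of $L$ is a Korkin-Zolotarev basis if, for each $i$, $b_i$ is a vector of smallest length among those vectors that minimize $\|\pi(b)\|$ over all $b \in L$ with $b \notin \mathrm{span}_{\mathbb{R}}(b_1, \dots, b_{i-1})$, where $\pi$ is the orthogonal projection onto $\mathrm{span}_{\mathbb{R}}(b_1, \dots, b_{i-1})^{\perp}$.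 In both definitions ties are resolved arbitrarily, so these bases need not be unique. The notation $a_i \uparrow \infty$ means that the sequence $(a_i)$ is increasing and tends to infinity. *)

(* Defs.v *)
From HB Require Import structures.
From mathcomp Require Import all_boot all_order all_algebra.
From mathcomp Require Import all_classical all_reals all_analysis.
From mathcomp Require Import ring.

Set Implicit Arguments.
Unset Strict Implicit.
Unset Printing Implicit Defensive.

Import Order.TTheory GRing.Theory Num.Theory.
Import numFieldNormedType.Exports.

Local Open Scope classical_set_scope.
Local Open Scope ring_scope.

(* The norm that the library puts on matrices is the sup norm, so the Euclidean
   inner product and norm are defined here. *)
Definition edot (R : realType) (m : nat) (x y : 'rV[R]_m) : R :=
  \sum_(j < m) x 0 j * y 0 j.

Definition enorm (R : realType) (m : nat) (x : 'rV[R]_m) : R :=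
  Num.sqrt (edot x x).

Section EdotInstances.
Variables (R : realType) (m : nat).

Fact edot_hermitian (x y : 'rV[R]_m) :
  edot x y = (-1) ^+ false * idfun (edot y x).
Proof. by rewrite mul1r; apply: eq_bigr => j _; rewrite mulrC. Qed.

Fact edot_bilinear : bilinear_for *%R (idfun \; *%R) (@edot R m).
Proof.
split=> u a x y; rewrite /edot /= mulr_sumr -big_split /=;
  by apply: eq_bigr => j _; rewrite !mxE; ring.
Qed.

HB.instance Definition _ := bilinear_isBilinear.Build R 'rV[R]_m 'rV[R]_m R
  *%R (idfun \; *%R) (@edot R m) edot_bilinear.

HB.instance Definition _ := isHermitianSesquilinear.Build R 'rV[R]_m
  false idfun (@edot R m) edot_hermitian.

Fact edot_gt0 (x : 'rV[R]_m) : x != 0 -> 0 < edot x x.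
Proof.
move=> x0; rewrite lt_def sumr_ge0 ?andbT => [|j _]; last by rewrite -expr2 sqr_ge0.
apply: contra x0; rewrite psumr_eq0 => [/allP h|j _]; last by rewrite -expr2 sqr_ge0.
apply/eqP/rowP => j; rewrite mxE; have := h j (mem_index_enum j).
by rewrite /= mulf_eq0 orbb => /eqP.
Qed.

HB.instance Definition _ := isDotProduct.Build R 'rV[R]_m (@edot R m) edot_gt0.
End EdotInstances.

(* Orthogonal projection onto the orthogonal complement of [U], as the
   projection onto that complement along [U]. *)
Definition perp_proj (R : realType) (m : nat) (U : {vspace 'rV[R]_m}) :
    'End('rV[R]_m) :=
  daddv_pi (orthov (@edot R m) U) U.

(* [perp_proj U x] is the unique vector orthogonal to [U] that differs from [x]
   by an element of [U]. *)
Lemma perp_projP (R : realType) (m : nat) (U : {vspace 'rV[R]_m})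
    (x p : 'rV[R]_m) :
  p = perp_proj U x <-> (x - p \in U) /\ (forall u, u \in U -> edot p u = 0).
Proof.
set W := orthov (@edot R m) U.
have cap0 : (W :&: U = 0)%VS.
  apply/eqP; rewrite -subv0; apply/subvP => y /memv_capP[/mem_orthovP yo yU].
  by rewrite memv0; apply: contraT => /edot_gt0; rewrite yo ?ltxx.
have full : (W + U = fullv)%VS.
  pose f : 'Hom('rV[R]_m, 'rV[R]_(\dim U)) :=
    linfun (mulmxr (\matrix_(j, i) (vbasis U)`_i 0 j)).
  have kW : (lker f <= W)%VS.
    apply/subvP => y; rewrite memv_ker lfunE /= => /eqP/rowP y0.
    apply/mem_orthovP => z /coord_vbasis ->; rewrite linear_sumr big1 // => i _.
    rewrite linearZr /=; have := y0 i; rewrite !mxE => yi.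
    by rewrite (_ : edot _ _ = 0) ?mulr0 // -[RHS]yi; apply: eq_bigr => j _; rewrite mxE.
  apply/eqP; rewrite eqEdim subvf /= dimv_disjoint_sum //.
  rewrite -(limg_ker_dim f) capfv leq_add ?dimvS //.
  by apply: leq_trans (dimvS (subvf _)) _; rewrite dimvf /dim /= mul1n.
have xE := daddv_pi_add cap0 (_ : x \in W + U)%VS.
have {xE} : perp_proj U x + daddv_pi U W x = x by apply: xE; rewrite full memvf.
have pW : perp_proj U x \in W by exact: memv_pi.
have qU : daddv_pi U W x \in U by exact: memv_pi.
move=> xE; split=> [->|[pU po]].
  by split=> [|u]; [rewrite -{1}xE addrC addKr|exact/mem_orthovP].
apply/eqP; rewrite -subr_eq0 -memv0 -cap0 memv_cap.
rewrite rpredB //; last exact/mem_orthovP.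
have -> : p - perp_proj U x = daddv_pi U W x - (x - p).
  by apply/eqP; rewrite subr_eq addrAC [X in X - _]addrC xE subKr.
by rewrite rpredB.
Qed.

Definition is_lattice (R : realType) (m : nat) (L : set 'rV[R]_m) : Prop :=
  [/\ L 0, forall x y, L x -> L y -> L (x - y) & L `<=` isolated L].

(* [V] is the real span of [L]: the least subspace containing [L]. *)
Definition is_real_span (R : realType) (m : nat) (L : set 'rV[R]_m)
    (V : {vspace 'rV[R]_m}) : Prop :=
  (forall x, L x -> x \in V) /\
  (forall W : {vspace 'rV[R]_m}, (forall x, L x -> x \in W) -> (V <= W)%VS).

Definition has_rank (R : realType) (m : nat) (L : set 'rV[R]_m) (n : nat) :
    Prop :=
  exists V : {vspace 'rV[R]_m}, is_real_span L V /\ \dim V = n.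

Definition is_basis (R : realType) (m : nat) (L : set 'rV[R]_m)
    (b : seq 'rV[R]_m) : Prop :=
  [/\ free b, forall x, x \in b -> L x & [set x | inIntSpan (in_tuple b) x] = L].

Definition is_primitive (R : realType) (m : nat) (L : set 'rV[R]_m)
    (s : seq 'rV[R]_m) : Prop :=
  exists t : seq 'rV[R]_m, is_basis L (s ++ t).

Definition minimizers (R : realType) (T : Type) (f : T -> R) (A : set T) :
    set T :=
  [set x | A x /\ forall y, A y -> f x <= f y].

(* Indices start at 0, so [take i b] is the sequence of the vectors of [b] that
   precede [b`_i]. *)
Definition is_minkowski_basis (R : realType) (m : nat) (L : set 'rV[R]_m)
    (b : seq 'rV[R]_m) : Prop :=
  is_basis L b /\
  forall i, (i < size b)%N ->
    minimizers (@enorm R m) [set x | L x /\ is_primitive L (rcons (take i b) x)]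
      b`_i.

Definition is_korkin_zolotarev_basis (R : realType) (m : nat)
    (L : set 'rV[R]_m) (b : seq 'rV[R]_m) : Prop :=
  is_basis L b /\
  forall i, (i < size b)%N ->
    let U := <<take i b>>%VS in
    minimizers (@enorm R m)
      (minimizers (fun x => enorm (perp_proj U x)) [set x | L x /\ x \notin U])
      b`_i.

(* Main.v *)
Require Import Defs.
From mathcomp Require Import all_boot all_order all_algebra.
From mathcomp Require Import all_classical all_reals all_analysis.
From mathcomp Require Import zify ring lra.

Set Implicit Arguments.
Unset Strict Implicit.
Unset Printing Implicit Defensive.

Import Order.TTheory GRing.Theory Num.Theory.
Import numFieldNormedType.Exports.

Local Open Scope classical_set_scope.
Local Open Scope ring_scope.

(** The lattice lives in R^(n+1), whose coordinates other than 0 are cut into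
    one block of p^2 - 1 coordinates for each prime p <= X.  It is generated by
    the unit vectors and, for each p, by the vector v_p with entries 1/p at
    coordinate 0 and on the block of p.  All nonzero vectors have norm >= 1, and
    the unit vectors and the v_p attain it.

    Block after block, v_p followed by all but one of the unit vectors of the
    block of p is a Korkin-Zolotarev basis: away from coordinate 0, v_p has
    squared norm 1 - 1/p^2 < 1, and once v_p is projected away the block is a
    dual root lattice A_r^*, whose minimal squared norm 1 - 1/(r+1) shrinks as
    the block is used up.  So this basis consists of vectors of norm 1.

    A Minkowski basis may start with all unit vectors except the one of
    coordinate 0.  The last vector must then generate the quotient, so it is
    nonintegral on every block, and each block contributes at least
    (p^2 - 1)/p^2 >= 3/4 to its squared norm.  With s = pi(X) blocks the rank is
    at most s X^2, and Chebyshev's bound X <= C s ln X turns 3s/4 into the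
    claimed power of the rank. *)

(** * Chebyshev's lower bound for the number of primes *)

Section Chebyshev.
Local Open Scope nat_scope.

Definition primes_upto (X : nat) : seq nat := [seq p <- iota 0 X.+1 | prime p].

Lemma mem_primes_upto X p : (p \in primes_upto X) = prime p && (p <= X)%N.
Proof. by rewrite mem_filter mem_iota add0n ltnS. Qed.

(** By Legendre's formula the exponent is the sum over k of floor(2m/p^k) - 2 floor(m/p^k). Each
    term is at most 1, and it vanishes once p^k > 2m. *)
Lemma logn_bin_double p m : prime p ->
  (logn p 'C(m.*2, m) <= trunc_log p m.*2)%N.
Proof.
move=> pp; have p1 := prime_gt1 pp.
have mm : (m <= m.*2)%N by rewrite -addnn leq_addr.
have := bin_fact mm; rewrite -{2}addnn addnK => /(congr1 (logn p)).
rewrite !lognM ?muln_gt0 ?fact_gt0 ?bin_gt0 // => E.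
rewrite -(leq_add2r (logn p m`! + logn p m`!)) E !logn_fact //.
(* The added terms vanish because m < p^k for k > m; both sums then have the same range. *)
have -> : \sum_(1 <= k < m.+1) m %/ p ^ k = \sum_(1 <= k < m.*2.+1) m %/ p ^ k.
  rewrite [RHS](big_cat_nat (n := m.+1)) //= [X in (_ + X)%N]big1_seq ?addn0 // => k.
  rewrite mem_index_iota => /andP[_ /andP[mk _]].
  by rewrite divn_small // (ltn_trans (ltn_expl m p1)) // ltn_exp2l.
(* Writing the logarithm as a sum of indicators makes the comparison termwise. *)
have -> : trunc_log p m.*2 = \sum_(1 <= k < m.*2.+1) (k <= trunc_log p m.*2)%N.
  have tl : (trunc_log p m.*2 < m.*2.+1)%N.
    case: (posnP m) => [->|m0]; first by rewrite trunc_log0.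
    rewrite ltnS; apply: leq_trans (trunc_logP p1 _); last by rewrite double_gt0.
    exact/ltnW/ltn_expl.
  rewrite (big_cat_nat (n := (trunc_log p m.*2).+1)) //= [X in (_ + X)%N]big1_seq.
    rewrite addn0 (eq_big_nat _ _ (F2 := fun=> 1%N)).
      by rewrite sum_nat_const_nat subn1 muln1.
    by move=> k /andP[_]; rewrite ltnS => ->.
  by move=> k; rewrite mem_index_iota ltnNge => /andP[_ /andP[/negbTE-> _]].
rewrite -!big_split /= leq_sum // => k _.
case: (leqP k) => kl.
  by rewrite -addnn divnD ?expn_gt0 ?prime_gt0 // addnC leq_add2r leq_b1.
rewrite divn_small //.
have [->|m0] := posnP m; first by rewrite expn_gt0 prime_gt0.
apply: leq_trans (trunc_log_ltn m.*2 p1) _; rewrite leq_exp2l //.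
Qed.

(** Consecutive central binomial coefficients have ratio 2(2m+1)/(m+1), which is at least 2. *)
Lemma expn2_le_bin_double m : (2 ^ m <= 'C(m.*2, m))%N.
Proof.
elim: m => // m IH.
have E : (m.+1 * 'C(m.+1.*2, m.+1) = 2 * (m.*2.+1 * 'C(m.*2, m)))%N.
  have := mul_bin_diag m.*2.+2 m; have := mul_bin_down m.*2.+1 m.
  rewrite doubleS /= (_ : m.*2.+1 - m = m.+1)%N; last by lia.
  by move=> H <-; rewrite H -doubleS -mul2n mulnA.
rewrite -(leq_pmul2l (ltn0Sn m)) E expnS; nia.
Qed.

(** With m = floor(X/2), every prime power exactly dividing the central binomial coefficient is at
    most X, and its primes are among those up to X. *)
Lemma chebyshev_lower X : (2 ^ X./2 <= X ^ size (primes_upto X))%N.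
Proof.
set m := X./2; set C := 'C(m.*2, m).
have mX : (m.*2 <= X)%N by rewrite /m; lia.
have C0 : (0 < C)%N by rewrite bin_gt0 -addnn leq_addr.
apply: leq_trans (expn2_le_bin_double m) _; rewrite -/C.
have [X0|X0] := posnP X.
  by rewrite /C /m X0 bin0 /primes_upto.
have le p : prime p -> (p ^ logn p C <= X)%N.
  move=> pp; have [m0|m0] := posnP m; first by rewrite /C m0 bin0 logn1.
  apply: leq_trans mX; apply: leq_trans (trunc_logP (prime_gt1 pp) _); last first.
    by rewrite double_gt0.
  by rewrite leq_exp2l ?prime_gt1 // logn_bin_double.
rewrite {1}(prod_prime_decomp C0) prime_decompE big_map /=.
apply: (@leq_trans (\prod_(p <- primes C) X)).
  by rewrite !big_seq; apply: leq_prod => p; rewrite mem_primes => /andP[pp _]; apply: le.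
rewrite big_const_seq count_predT iter_muln_1 leq_pexp2l //.
apply: uniq_leq_size (primes_uniq C) _ => p pC; have := pC.
rewrite mem_primes_upto mem_primes => /and3P[pp _ _]; rewrite pp.
apply: leq_trans (le p pp); rewrite -{1}(expn1 p) leq_exp2l ?prime_gt1 //.
by rewrite logn_gt0.
Qed.

End Chebyshev.

(** * Two bounds on squared norms *)

(** With r = #|S|, such a [y] is an integer vector translated along the diagonal. The bound is the
    minimum of the dual root lattice A_(r-1)^*, the projection of Z^r away from the diagonal. *)
Lemma variance_ge (R : realType) (I : finType) (S : {pred I}) (y : I -> R) (s t : I) :
  s \in S -> t \in S -> y s != y t ->
  {in S &, forall j k, y j - y k \is a Num.int} ->
  1 - #|S|%:R^-1 <= \sum_(j in S) y j ^+ 2.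
Proof.
move=> Ss St yst yZ.
pose m := [arg min_(j < s in S) y j]%O.
have [mS mmin] : m \in S /\ forall j, j \in S -> y m <= y j.
  by rewrite /m; case: Order.TotalTheory.arg_minP => // j Sj jmin; split=> // k; apply: jmin.
have gap j : j \in S -> y j != y m -> y m + 1 <= y j.
  move=> Sj yjm; have jm : y m < y j by rewrite lt_neqAle eq_sym yjm mmin.
  have := norm_intr_ge1 (yZ j m Sj mS); rewrite subr_eq0 yjm => /(_ isT).
  by rewrite gtr0_norm ?subr_gt0 // lerBrDl.
have r0 : (0 : R) < #|S|%:R by rewrite ltr0n; apply/card_gt0P; exists s.
have rV : (0 : R) < #|S|%:R^-1 by rewrite invr_gt0.
(* Let [c] be the minimal value and [a], [b] the numbers of indices attaining
   and exceeding it.  For [c > -1] the sum is at least [a c^2 + b (c+1)^2], which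
   is at least [a b / (a + b)]. *)
have [ym|ym] := leP (y m) (-1).
  apply: (@le_trans _ _ 1); first by rewrite gerBl ltW.
  rewrite (bigD1 m) //=; have : 0 <= \sum_(j in S | j != m) y j ^+ 2.
    by apply: sumr_ge0 => j _; rewrite sqr_ge0.
  nra.
pose A := [pred j in S | y j == y m]; pose B := [pred j in S | y j != y m].
have cS : #|S| = (#|A| + #|B|)%N.
  rewrite -(cardID [pred j | y j == y m] S); congr (_ + _)%N; apply: eq_card => j.
  by rewrite !inE andbC.
have a1 : (0 < #|A|)%N by apply/card_gt0P; exists m; rewrite inE mS /= eqxx.
have b1 : (0 < #|B|)%N.
  apply/card_gt0P; have [sm|sm] := eqVneq (y s) (y m).
    by exists t; rewrite inE St /= -sm eq_sym.
  by exists s; rewrite inE Ss.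
have lb : #|A|%:R * y m ^+ 2 + #|B|%:R * (y m + 1) ^+ 2 <= \sum_(j in S) y j ^+ 2.
  rewrite (bigID (fun j => y j == y m)) /= lerD //.
    rewrite (eq_bigr (fun=> y m ^+ 2)) => [|j /andP[_ /eqP->]//].
    by rewrite sumr_const -[leRHS]mulr_natl.
  rewrite mulr_natl -sumr_const; apply: ler_sum => j /andP[Sj yj].
  by rewrite lerXn2r ?nnegrE ?gap //; [lra|have := gap j Sj yj; lra].
apply: le_trans lb; rewrite -(ler_pM2l r0) mulrBr mulr1 mulfV ?gt_eqF // cS natrD.
have : (1 : R) <= #|A|%:R by rewrite ler1n.
have : (1 : R) <= #|B|%:R by rewrite ler1n.
move: (#|A|%:R) (#|B|%:R) (y m) => a b c hb ha.
(* Completing the square leaves a b, and a b >= a + b - 1 since (a - 1)(b - 1) >= 0. *)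
have -> : (a + b) * (a * c ^+ 2 + b * (c + 1) ^+ 2) =
  ((a + b) * c + b) ^+ 2 + a * b by ring.
have := sqr_ge0 ((a + b) * c + b); nra.
Qed.

(** By Pythagoras the projection is the shortest vector of the coset [x + U], so any explicit member
    of the coset bounds it from above. *)
Lemma edot_perp_proj_le (R : realType) (m : nat) (U : {vspace 'rV[R]_m})
    (x y : 'rV[R]_m) :
  x - y \in U -> edot (perp_proj U x) (perp_proj U x) <= edot y y.
Proof.
move=> xyU; have /perp_projP := erefl (perp_proj U x).
move: (perp_proj U x) => p [xpU p_perp].
have dU : y - p \in U.
  rewrite (_ : y - p = (x - p) - (x - y)); first exact: rpredB.
  by rewrite opprB [RHS]addrC addrA subrK.
have -> : edot y y = edot p p + edot (y - p) (y - p) + 2 * edot p (y - p).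
  rewrite /edot mulr_sumr -!big_split /=.
  by apply: eq_bigr => j _; rewrite !mxE; ring.
rewrite (p_perp _ dU) mulr0 addr0.
by rewrite lerDl /edot sumr_ge0 // => j _; rewrite -expr2 sqr_ge0.
Qed.

(** * Blocks, the candidate basis and its dual forms *)

Section BlockLattice.
(* [q i] is the prime labelling the block of coordinate [i]; coordinate 0 forms a
   block of its own, labelled 1. *)
Variables (R : realType) (n : nat) (q : 'I_n.+1 -> nat).
Hypothesis q0 : q ord0 = 1%N.
Hypothesis q_prime : forall i, i != ord0 -> prime (q i).
Hypothesis q_mono : forall i j : 'I_n.+1, (i <= j)%N -> (q i <= q j)%N.
Hypothesis q_card :
  forall i, i != ord0 -> #|[pred j | q j == q i]| = (q i ^ 2).-1.

Implicit Types (i j a : 'I_n.+1) (x y w : 'rV[R]_n.+1).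

(** For [i] other than [ord0], this is the coordinate whose unit vector is left out of the basis;
    v_p takes its position. *)
Definition leader i : 'I_n.+1 := [arg min_(j < i | q j == q i) (j : nat)].

Lemma leaderP i : q (leader i) = q i /\ forall j, q j = q i -> (leader i <= j)%N.
Proof.
rewrite /leader; case: arg_minnP => // j /eqP qj jmin.
by split=> // k qk; apply: jmin; apply/eqP.
Qed.

Lemma q_leader i : q (leader i) = q i. Proof. by case: (leaderP i). Qed.

Lemma leader_min i j : q j = q i -> (leader i <= j)%N.
Proof. by case: (leaderP i) => _; apply. Qed.

Lemma leader_le i : (leader i <= i)%N. Proof. exact: leader_min. Qed.

Lemma leader_eq i j : (leader i == leader j) = (q i == q j).
Proof.
apply/eqP/eqP => [E|E]; first by rewrite -q_leader E q_leader.
by apply/val_inj/eqP; rewrite eqn_leq !leader_min // q_leader.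
Qed.

Lemma leaderK i : leader (leader i) = leader i.
Proof. by apply/eqP; rewrite leader_eq q_leader. Qed.

Lemma ord_neq0_le i j : i != ord0 -> (i <= j)%N -> j != ord0.
Proof. by rewrite -!val_eqE /= -!lt0n; apply: leq_trans. Qed.

Lemma q_gt1 i : i != ord0 -> (1 < q i)%N.
Proof. by move/q_prime/prime_gt1. Qed.

Lemma q_eq1 i : (q i == 1%N) = (i == ord0).
Proof.
apply/eqP/eqP => [E|->//]; apply/eqP/contraT => /q_gt1; by rewrite E.
Qed.

Lemma leader_eq0 i : (leader i == ord0) = (i == ord0).
Proof. by rewrite -!q_eq1 q_leader. Qed.

Lemma q_gt0 i : (0 < q i)%N.
Proof.
by have [->|/q_gt1/ltnW//] := eqVneq i ord0; rewrite q0.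
Qed.

Lemma qR_neq0 i : (q i)%:R != 0 :> R.
Proof. by rewrite pnatr_eq0 -lt0n q_gt0. Qed.

Definition leading a := (a != ord0) && (leader a == a).

(* The linear forms dual to the basis [kz_vec] below. *)
Definition phi i x : R :=
  if i == ord0 then x 0 ord0 - \sum_(a | leading a) x 0 a
  else if leader i == i then (q i)%:R * x 0 i else x 0 i - x 0 (leader i).

(** The unit vector of coordinate 0 comes first, so that coordinate 0 is already projected away when
    the first v_p is reached. *)
Definition kz_vec i : 'rV[R]_n.+1 :=
  if (i == ord0) || (leader i != i) then delta_mx 0 i
  else \row_j (((j == ord0) || (q j == q i))%:R / (q i)%:R).

(** The leader coordinate of a block determines the coefficient of v_p; unit vectors then correct
    the rest of the block and coordinate 0. *)
Lemma kz_vec_decomp x : x = \sum_i phi i x *: kz_vec i.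
Proof.
apply/rowP => j; rewrite summxE.
under eq_bigr => i _ do rewrite mxE.
have [->{j}|j0] := eqVneq j ord0.
  rewrite (bigD1 ord0) //= /kz_vec /phi eqxx /= mxE !eqxx mulr1.
  rewrite [X in _ = _ + X](_ : _ = \sum_(a | leading a) x 0 a) ?subrK //.
  rewrite /leading big_mkcondr /=; apply: eq_bigr => i /negbTE i0; rewrite i0 /=.
  case: eqP => _ /=; rewrite mxE.
    by rewrite eqxx /= div1r mulrAC divff ?mul1r ?qR_neq0.
  by rewrite (eq_sym ord0) i0 andbF mulr0.
have hj0 : (leader j == ord0) = false by rewrite leader_eq0 (negbTE j0).
have z k : k != j -> k != leader j -> phi k x * kz_vec k 0 j = 0.
  move=> kj khj; rewrite /kz_vec; case: ifP => [_|].
    by rewrite mxE (eq_sym j) (negbTE kj) andbF mulr0.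
  move/negbT; rewrite negb_or negbK => /andP[k0 /eqP hk]; rewrite mxE (negbTE j0) /=.
  by rewrite -leader_eq hk (eq_sym _ k) (negbTE khj) mul0r mulr0.
have E : phi (leader j) x * kz_vec (leader j) 0 j = x 0 (leader j).
  rewrite /phi /kz_vec hj0 leaderK eqxx /= mxE (negbTE j0) q_leader eqxx /=.
  by rewrite div1r mulrAC divff ?mul1r ?qR_neq0.
rewrite (bigD1 (leader j)) //= E; have [hj|hj] := eqVneq (leader j) j.
  by rewrite big1 ?addr0 ?hj // => k kj; apply: z; rewrite ?hj // -hj.
rewrite (bigD1 j) /= 1?eq_sym // big1 => [|k /andP[khj kj]]; last exact: z.
by rewrite /phi /kz_vec (negbTE j0) hj (negbTE hj) mxE !eqxx /= mulr1 addr0 addrC subrK.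
Qed.

Definition kz_seq : n.+1.-tuple 'rV[R]_n.+1 := [tuple kz_vec i | i < n.+1].

Lemma nth_kz_seq i : kz_seq`_i = kz_vec i.
Proof. by rewrite -tnth_nth tnth_mktuple. Qed.

Lemma span_kz_seq : <<kz_seq>>%VS = fullv.
Proof.
apply/eqP; rewrite eqEsubv subvf /=; apply/subvP => x _.
rewrite (kz_vec_decomp x) rpred_sum // => i _; apply/rpredZ/memv_span.
by rewrite -nth_kz_seq mem_nth // size_tuple.
Qed.

Lemma dim_rV : \dim {: 'rV[R]_n.+1} = n.+1.
Proof. by rewrite dimvf /dim /= mul1n. Qed.

Lemma free_kz_seq : free kz_seq.
Proof. by rewrite /free span_kz_seq dim_rV size_tuple. Qed.

Lemma phi_coord i x : phi i x = coord kz_seq i x.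
Proof.
rewrite [in RHS](kz_vec_decomp x).
under eq_bigr => k _ do rewrite -nth_kz_seq.
by rewrite coord_sum_free // free_kz_seq.
Qed.

Lemma phi_kz_vec i j : phi i (kz_vec j) = (i == j)%:R.
Proof. by rewrite phi_coord -nth_kz_seq coord_free ?free_kz_seq // eq_sym. Qed.

Lemma phiB i x y : phi i (x - y) = phi i x - phi i y.
Proof. by rewrite !phi_coord linearB. Qed.

Lemma mem_span_take k x :
  reflect (forall i, (k <= i)%N -> phi i x = 0) (x \in <<take k kz_seq>>%VS).
Proof.
apply: (iffP idP) => [xk i ki|x0].
  rewrite (coord_span (X := in_tuple (take k kz_seq)) xk) phi_coord linear_sum big1 // => j _.
  have jk : (j < k)%N.
    by apply: leq_trans (ltn_ord j) _; rewrite size_take; case: ltnP.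
  have jn : (j < n.+1)%N.
    by apply: leq_trans (ltn_ord j) _; rewrite size_take size_tuple; case: ltnP => // /ltnW.
  rewrite linearZ /= nth_take // -[X in kz_seq`_X]/(val (Ordinal jn)) coord_free ?free_kz_seq //.
  by rewrite -val_eqE /= ltn_eqF ?mulr0 // (leq_trans jk).
rewrite (kz_vec_decomp x) rpred_sum // => i _.
have [ik|/x0->] := ltnP i k; last by rewrite scale0r mem0v.
apply/rpredZ/memv_span; rewrite -nth_kz_seq -(nth_take _ ik) mem_nth //.
by rewrite size_take size_tuple; case: ifP => // _; exact: ltn_ord.
Qed.

(** * The lattice and the integrality of its coordinates *)

(** Integrality of the dual forms makes membership checkable one form at a time; [kz_seq_basis]
    identifies this set with the integer span of [kz_seq]. *)
Definition blattice : set 'rV[R]_n.+1 :=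
  [set x | forall i, phi i x \is a Num.int].

Lemma blattice_kz_vec i : blattice (kz_vec i).
Proof. by move=> j; rewrite phi_kz_vec natr_int. Qed.

Lemma blatticeB x y : blattice x -> blattice y -> blattice (x - y).
Proof. by move=> Lx Ly i; rewrite phiB rpredB. Qed.

Lemma blattice_int x : (forall j, x 0 j \is a Num.int) -> blattice x.
Proof.
move=> xZ i; rewrite /phi; case: ifP => _; first by rewrite rpredB ?rpred_sum.
by case: ifP => _; rewrite ?rpredM ?rpredB ?natr_int.
Qed.

Lemma blattice_leader x i : blattice x -> i != ord0 -> x 0 i - x 0 (leader i) \is a Num.int.
Proof.
move=> /(_ i) + /negbTE i0; rewrite /phi i0; case: eqP => [->|//].
by rewrite subrr rpred0.
Qed.

Lemma blattice_same x i j : blattice x -> i != ord0 -> q i = q j ->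
  x 0 i - x 0 j \is a Num.int.
Proof.
move=> Lx i0 ij; have j0 : j != ord0 by rewrite -q_eq1 -ij q_eq1.
have -> : x 0 i - x 0 j = (x 0 i - x 0 (leader i)) - (x 0 j - x 0 (leader j)).
  by rewrite (eqP (_ : leader i == leader j)) ?leader_eq ?ij //; ring.
by rewrite rpredB ?blattice_leader.
Qed.

Lemma blattice_same_int x i j : blattice x -> i != ord0 -> q i = q j ->
  (x 0 i \is a Num.int) = (x 0 j \is a Num.int).
Proof.
move=> Lx i0 ij; have := blattice_same Lx i0 ij.
by move=> h; rewrite -[x 0 i](subrK (x 0 j)) rpredDl.
Qed.

Lemma blattice_q x i : blattice x -> i != ord0 -> (q i)%:R * x 0 i \is a Num.int.
Proof.
move=> Lx i0; rewrite -[x 0 i](subrK (x 0 (leader i))) mulrDr.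
apply: rpredD; first by rewrite rpredM ?natr_int ?blattice_leader.
by have := Lx (leader i); rewrite /phi leader_eq0 (negbTE i0) leaderK eqxx q_leader.
Qed.

Lemma blattice_x0 x : blattice x ->
  (x 0 ord0 \is a Num.int) = (\sum_(a | leading a) x 0 a \is a Num.int).
Proof.
move=> /(_ ord0); rewrite /phi eqxx => h.
by rewrite -[x 0 ord0](subrK (\sum_(a | leading a) x 0 a)) rpredDl.
Qed.

Lemma coprime_int (p m : nat) (z : R) : coprime p m ->
  p%:R * z \is a Num.int -> m%:R * z \is a Num.int -> z \is a Num.int.
Proof.
move=> pm pz mz; have /coprimezP[[u v] /= uv] : coprimez p m by [].
have -> : z = u%:~R * (p%:R * z) + v%:~R * (m%:R * z).
  have /(congr1 (fun t : int => t%:~R : R)) := uv.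
  rewrite rmorphD !rmorphM /= -!pmulrn => E.
  by rewrite !mulrA -mulrDl E mul1r.
by rewrite rpredD // rpredM ?intr_int.
Qed.

(** Modulo 1, coordinate 0 is the sum of the leader coordinates, whose denominators divide distinct
    primes. As with partial fractions, an integral sum forces every summand to be integral. *)
Lemma blattice_coord0_int x : blattice x -> x 0 ord0 \is a Num.int ->
  forall j, x 0 j \is a Num.int.
Proof.
move=> Lx x0 j; have [->//|j0] := eqVneq j ord0.
pose a := leader j; have ha : leading a by rewrite /leading leader_eq0 j0 leaderK eqxx.
rewrite (blattice_same_int (j := a)) // ?q_leader //.
have a0 : a != ord0 by case/andP: ha.
move: x0; rewrite blattice_x0 // => sZ.
(* [Q] clears the denominators of all other summands and is coprime to [q a]. *)
pose Q := (\prod_(b | leading b && (b != a)) q b)%N.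
apply: (@coprime_int (q a) Q) (blattice_q Lx a0) _.
  rewrite /Q; elim/big_rec: _ => [|b m /andP[/andP[b0 /eqP hb] ba] IH].
    exact: coprimen1.
  rewrite coprimeMr IH andbT prime_coprime ?q_prime // dvdn_prime2 ?q_prime //.
  by rewrite -leader_eq leaderK eq_sym hb.
have -> : Q%:R * x 0 a =
    Q%:R * (\sum_(b | leading b) x 0 b) - Q%:R * \sum_(b | leading b && (b != a)) x 0 b.
  by rewrite -mulrBr (bigD1 a) //= addrK.
apply: rpredB; first by rewrite rpredM ?natr_int.
rewrite mulr_sumr; apply: rpred_sum => b hb.
have b0 : b != ord0 by case/andP: hb => /andP[].
rewrite /Q (bigD1 b) //= mulnC natrM -mulrA.
by rewrite rpredM ?natr_int ?blattice_q.
Qed.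

(** * Squared norms of lattice vectors *)

Lemma edot_sqr x : edot x x = \sum_j x 0 j ^+ 2.
Proof. by []. Qed.

Lemma edot_blocks x : edot x x =
  x 0 ord0 ^+ 2 + \sum_(a | leading a) \sum_(k | q k == q a) x 0 k ^+ 2.
Proof.
rewrite edot_sqr (bigD1 ord0) //= (partition_big leader leading) /=; last first.
  by move=> k k0; rewrite /leading leader_eq0 k0 leaderK eqxx.
congr (_ + _); apply: eq_bigr => a /andP[a0 /eqP ha]; apply: eq_bigl => k.
rewrite -leader_eq ha andb_idl // => /eqP ka; by rewrite -leader_eq0 ka.
Qed.

Lemma sum_block i : i != ord0 ->
  \sum_(k | q k == q i) (q i)%:R ^- 2 = 1 - (q i)%:R ^- 2 :> R.
Proof.
move=> i0; rewrite sumr_const q_card // -subn1 -[LHS]mulr_natr natrB ?expn_gt0 ?q_gt0 //.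
by rewrite natrX mulrBr mulVf ?mulr1 ?expf_neq0 ?qR_neq0.
Qed.

(** All coordinates in the block are congruent modulo 1, so none is integral. Each is thus a nonzero
    multiple of 1/p, and there are p^2 - 1 of them. *)
Lemma block_nonint x j : blattice x -> j != ord0 -> x 0 j \isn't a Num.int ->
  1 - (q j)%:R ^- 2 <= \sum_(k | q k == q j) x 0 k ^+ 2.
Proof.
move=> Lx j0 xj.
rewrite -sum_block //; apply: ler_sum => k /eqP kj.
have k0 : k != ord0 by rewrite -q_eq1 kj q_eq1.
have xk : x 0 k \isn't a Num.int by rewrite (blattice_same_int (j := j)).
have := sqr_intr_ge1 (blattice_q Lx k0) _; rewrite mulf_eq0 (negbTE (qR_neq0 k)) /=.
have -> : x 0 k != 0 by apply: contraNneq xk => ->; rewrite rpred0.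
move=> /(_ isT); rewrite exprMn -kj => h.
rewrite -(ler_pM2l (_ : 0 < (q k)%:R ^+ 2)) ?exprn_gt0 ?ltr0n ?q_gt0 //.
by rewrite mulfV ?expf_neq0 ?qR_neq0.
Qed.

Lemma qV2_ge0 j : 0 <= (q j)%:R ^- 2 :> R.
Proof. by rewrite invr_ge0 exprn_ge0. Qed.

Lemma block_ge x j : blattice x -> j != ord0 -> x 0 j != 0 ->
  1 - (q j)%:R ^- 2 <= \sum_(k | q k == q j) x 0 k ^+ 2.
Proof.
move=> Lx j0 xj; have [xZ|] := boolP (x 0 j \is a Num.int); last exact: block_nonint.
apply: (@le_trans _ _ 1); first by rewrite gerBl qV2_ge0.
rewrite (bigD1 j) //=; apply: le_trans (sqr_intr_ge1 xZ xj) _.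
by rewrite lerDl sumr_ge0 // => k _; rewrite sqr_ge0.
Qed.

Lemma qV2_le4 j : j != ord0 -> (q j)%:R ^- 2 <= 4^-1 :> R.
Proof.
move=> j0; rewrite lef_pV2 ?posrE ?exprn_gt0 ?ltr0n ?q_gt0 //.
by rewrite (_ : 4 = 2 ^+ 2) ?lerXn2r ?nnegrE // ?ler_nat ?q_gt1 // -natrX.
Qed.

Lemma edot_coord x j : x 0 j ^+ 2 <= edot x x.
Proof.
by rewrite edot_sqr (bigD1 j) //= lerDl sumr_ge0 // => k _; rewrite sqr_ge0.
Qed.

(** The cases are the number of nonintegral blocks. With none, the vector is integral. With exactly
    one, coordinate 0 is nonintegral as well and supplies the missing 1/p^2. With two, each
    contributes at least 3/4. *)
Lemma edot_ge1 x : blattice x -> x != 0 -> 1 <= edot x x.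
Proof.
move=> Lx xN0; have [xZ|] := boolP [forall (a | leading a), x 0 a \is a Num.int].
  have {}xZ : x 0 ord0 \is a Num.int.
    by rewrite blattice_x0 // rpred_sum // => a ha; have /forall_inP := xZ; apply.
  have {}xZ := blattice_coord0_int Lx xZ.
  have /existsP[j xj] : [exists j, x 0 j != 0].
    rewrite -negb_forall; apply: contraNN xN0 => /forallP x0.
    by apply/eqP/rowP => j; rewrite mxE; apply/eqP.
  by apply: le_trans (edot_coord x j); apply: sqr_intr_ge1.
rewrite negb_forall_in => /existsP[a /andP[ha xa]].
have a0 : a != ord0 by case/andP: ha.
have xge := block_nonint Lx a0 xa.
have bge0 b : 0 <= \sum_(k | q k == q b) x 0 k ^+ 2.
  by apply: sumr_ge0 => k _; rewrite sqr_ge0.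
rewrite edot_blocks (bigD1 a) //=.
have [xZ|] := boolP [forall (b | leading b && (b != a)), x 0 b \is a Num.int].
  have h : x 0 ord0 - x 0 a \is a Num.int.
    have := Lx ord0; rewrite /phi eqxx (bigD1 a) //= opprD addrA => h.
    rewrite -[X in X \is a _](subrK (\sum_(i | leading i && (i != a)) x 0 i)) rpredD //.
    by rewrite rpred_sum // => b hb; have /forall_inP := xZ; apply.
  have qx : (q a)%:R * x 0 ord0 \is a Num.int.
    rewrite -[x 0 ord0](subrK (x 0 a)) mulrDr; apply: rpredD; last exact: blattice_q.
    by rewrite rpredM ?natr_int.
  have x0 : x 0 ord0 != 0.
    by apply: contraNneq xa => x00; move: h; rewrite x00 sub0r rpredN.
  have := sqr_intr_ge1 qx; rewrite mulf_eq0 (negbTE (qR_neq0 a)) x0 => /(_ isT).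
  rewrite exprMn -ler_pdivrMl ?exprn_gt0 ?ltr0n ?q_gt0 // mulr1 => x0ge.
  have : 0 <= \sum_(i | leading i && (i != a)) \sum_(k | q k == q i) x 0 k ^+ 2.
    by apply: sumr_ge0 => b _.
  lra.
rewrite negb_forall_in => /existsP[b /andP[/andP[hb ba] xb]].
rewrite [X in _ + (_ + X)](bigD1 b) ?hb //=.
have b0 : b != ord0 by case/andP: hb.
have xbge := block_nonint Lx b0 xb.
have := qV2_le4 a0; have := qV2_le4 b0; have := sqr_ge0 (x 0 ord0).
have : 0 <= \sum_(i | leading i && (i != a) && (i != b)) \sum_(k | q k == q i) x 0 k ^+ 2.
  by apply: sumr_ge0 => c _.
lra.
Qed.

(** * Projected lengths and the Korkin-Zolotarev basis *)

Lemma span_take_tail i j w : i != ord0 -> w \in <<take i kz_seq>>%VS ->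
  (i <= leader j)%N -> w 0 j = 0.
Proof.
move=> i0 /mem_span_take wU ij.
have hj0 : leader j != ord0 by exact: ord_neq0_le ij.
have /eqP : phi (leader j) w = 0 by exact: wU.
rewrite /phi (negbTE hj0) leaderK eqxx mulf_eq0 (negbTE (qR_neq0 _)) /= => /eqP wh.
have := wU j (leq_trans ij (leader_le j)).
rewrite /phi -leader_eq0 (negbTE hj0); case: eqP => [hj _|_]; first by rewrite -hj.
by rewrite wh subr0.
Qed.

(** Among the vectors before position [i], at most v_p touches coordinate [j] or its leader, and v_p
    is constant on the block. *)
Lemma span_take_leader i j w : i != ord0 -> w \in <<take i kz_seq>>%VS ->
  (i <= j)%N -> w 0 j = w 0 (leader j).
Proof.
move=> i0 /mem_span_take wU ij; have := wU j ij.
have j0 : j != ord0 by exact: ord_neq0_le ij.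
rewrite /phi (negbTE j0); case: eqP => [->//|_] /eqP.
by rewrite subr_eq0 => /eqP.
Qed.

(* Modulo the vectors preceding [kz_vec i], the block of [i] is the projection of
   these coordinates orthogonally to their diagonal. *)
Definition active i : {pred 'I_n.+1} :=
  [pred j | (q j == q i) && ((i <= j)%N || (j == leader i))].

(* The squared norm of the projection of [kz_vec i], see [kz_vec_kappa]. *)
Definition kappa i : R :=
  if leader i == i then 1 - (q i)%:R ^- 2 else 1 - #|active i|%:R^-1.

Lemma active_leader i : leader i \in active i.
Proof. by rewrite inE q_leader !eqxx orbT. Qed.

Lemma active_id i : i \in active i.
Proof. by rewrite inE eqxx leqnn. Qed.

Lemma active_gt0 i : (0 < #|active i|)%N.
Proof. by apply/card_gt0P; exists i; exact: active_id. Qed.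

(** The active coordinates lie in a block of p^2 - 1 elements. Hence blocks of larger primes cannot
    offer a shorter projection. *)
Lemma kappa_le i : i != ord0 -> kappa i <= 1 - (q i)%:R ^- 2.
Proof.
move=> i0; rewrite /kappa; case: ifP => // _; rewrite lerD2l lerN2.
rewrite lef_pV2 ?posrE ?ltr0n ?active_gt0 ?exprn_gt0 ?ltr0n ?q_gt0 // -natrX ler_nat.
apply: leq_trans (leq_pred _); rewrite -(q_card i0).
by apply: subset_leq_card; apply/fintype.subsetP => j; rewrite !inE => /andP[].
Qed.

(** If [x] is nonzero on a block starting at or after [i], then [y] agrees with it there and
    [block_ge] suffices, the primes being increasing. Otherwise [x] is not constant on the active
    coordinates of the block of [i], and [variance_ge] applies. *)
Lemma kappa_le_edot i x y : i != ord0 -> blattice x -> x \notin <<take i kz_seq>>%VS ->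
  x - y \in <<take i kz_seq>>%VS -> kappa i <= edot y y.
Proof.
move=> i0 Lx xU wU.
have yE j : (i <= leader j)%N -> y 0 j = x 0 j.
  by move=> ij; have := span_take_tail i0 wU ij; rewrite !mxE => /eqP; rewrite subr_eq0 => /eqP.
have [/existsP[j /andP[ij xj]]|] := boolP [exists j : 'I_n.+1, (i <= leader j)%N && (x 0 j != 0)].
  have j0 : j != ord0 by rewrite -leader_eq0; exact: ord_neq0_le ij.
  apply: le_trans (kappa_le i0) _; apply: (@le_trans _ _ (1 - (q j)%:R ^- 2)).
    rewrite lerD2l lerN2 lef_pV2 ?posrE ?exprn_gt0 ?ltr0n ?q_gt0 //.
    by rewrite lerXn2r ?nnegrE // ler_nat q_mono // (leq_trans ij) ?leader_le.
  apply: le_trans (block_ge Lx j0 xj) _.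
  rewrite edot_sqr [leRHS](bigID (fun k => q k == q j)) /= -[leLHS]addr0 lerD //.
    rewrite le_eqVlt; apply/orP; left; apply/eqP/eq_bigr => k /eqP kj.
    by rewrite yE // (eqP (_ : leader k == leader j)) ?leader_eq ?kj.
  by apply: sumr_ge0 => k _; rewrite sqr_ge0.
rewrite negb_exists => /forallP x0.
have {}x0 j : (i <= leader j)%N -> x 0 j = 0.
  by move=> ij; have := x0 j; rewrite ij /= negbK => /eqP.
have /existsP[j /andP[ij xj]] : [exists j : 'I_n.+1, (i <= j)%N && (phi j x != 0)].
  apply: contraR xU; rewrite negb_exists => /forallP h; apply/mem_span_take => j ij.
  by have := h j; rewrite ij /= negbK => /eqP.
have j0 : j != ord0 by exact: ord_neq0_le ij.
have hji : (leader j < i)%N.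
  rewrite ltnNge; apply: contra xj => hij; rewrite /phi (negbTE j0).
  by rewrite !x0 ?leaderK // subrr mulr0 if_same.
have hjN : leader j != j by apply: contraTneq hji => ->; rewrite -leqNgt.
move: xj; rewrite /phi (negbTE j0) (negbTE hjN) subr_eq0 => xj.
(* As [leader j < i <= j], monotonicity of [q] puts [i] and [j] in one block. *)
have hij : leader j = leader i.
  apply/eqP; rewrite leader_eq eqn_leq [X in _ && X]q_mono // andbT.
  by rewrite -q_leader q_mono // ltnW.
have hiN : leader i != i by apply: contraTneq hji; rewrite hij => ->; rewrite ltnn.
have hii : (leader i < i)%N by rewrite -hij.
have wS k : k \in active i -> x 0 k - y 0 k = x 0 (leader i) - y 0 (leader i).
  rewrite inE => /andP[qk /orP[ik|/eqP->//]].
  have := span_take_leader i0 wU ik; rewrite !mxE.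
  by rewrite (eqP (_ : leader k == leader i)) ?leader_eq.
have jS : j \in active i by rewrite inE -leader_eq hij eqxx ij.
have yS k l : k \in active i -> l \in active i -> y 0 k - y 0 l = x 0 k - x 0 l.
  by move=> /wS + /wS; lra.
rewrite /kappa (negbTE hiN).
apply: le_trans (variance_ge (y := fun k => y 0 k) jS (active_leader i) _ _) _.
- by rewrite -subr_eq0 yS ?active_leader // subr_eq0 -hij.
- move=> k l kS lS; rewrite yS //; move: kS lS; rewrite !inE => /andP[/eqP qk _] /andP[/eqP ql _].
  by apply: blattice_same => //; rewrite ?qk ?ql // -q_eq1 qk q_eq1.
- rewrite edot_sqr [leRHS](bigID (mem (active i))) /= lerDl.
  by apply: sumr_ge0 => k _; rewrite sqr_ge0.
Qed.

(** The bound of [kappa_le_edot] is attained by an explicit member of the coset of [kz_vec i]. *)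
Lemma kz_vec_kappa i : i != ord0 ->
  exists2 y, kz_vec i - y \in <<take i kz_seq>>%VS & edot y y = kappa i.
Proof.
move=> i0; have k0 (k : 'I_n.+1) : (i <= k)%N -> k != ord0 by exact: ord_neq0_le.
rewrite /kappa /kz_vec (negbTE i0) /=; case: eqP => [hi|/eqP hi] /=.
  (* This is v_p with coordinate 0 removed. *)
  exists (\row_j ((q j == q i)%:R / (q i)%:R)).
    apply/mem_span_take => k /k0 kN; rewrite /phi (negbTE kN) !mxE leader_eq0 (negbTE kN) /=.
    by rewrite !subrr mulr0 if_same.
  rewrite edot_sqr -sum_block // [RHS]big_mkcond /=; apply: eq_bigr => k _; rewrite mxE.
  by case: eqP => _; rewrite ?mul0r ?expr0n // div1r exprVn.
pose r : R := #|active i|%:R.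
have r0 : r != 0 by rewrite pnatr_eq0 -lt0n active_gt0.
(* This is the unit vector minus its mean over the active coordinates. *)
exists (\row_j ((j == i)%:R - (j \in active i)%:R / r)).
  rewrite (_ : _ - _ = \row_j ((j \in active i)%:R / r)); last first.
    by apply/rowP => j; rewrite !mxE eqxx opprB addrC subrK.
  apply/mem_span_take => k ik; have kN := k0 k ik; rewrite /phi (negbTE kN) !mxE.
  have kA : (k \in active i) = (q k == q i) by rewrite inE ik /= andbT.
  case: eqP => [hk|_].
    rewrite kA -leader_eq hk; case: eqP => [ki|_]; last by rewrite mul0r mulr0.
    suff : (i <= leader i)%N by rewrite leqNgt ltn_neqAle leader_le val_eqE hi.
    by rewrite -ki.
  by rewrite kA inE q_leader -leader_eq; case: eqP => [->|_] /=; rewrite ?eqxx ?orbT subrr.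
rewrite edot_sqr (eq_bigr (fun j => (j == i)%:R * (1 - 2 / r) + (j \in active i)%:R / r ^+ 2)).
  rewrite big_split /= -!mulr_suml -!natr_sum (_ : (\sum_j (j == i) = 1)%N); last first.
    by rewrite (bigD1 i) //= eqxx big1 // => j /negbTE->.
  rewrite (_ : (\sum_j (j \in active i) = #|active i|)%N) -/r; last first.
    by rewrite -sum1_card [RHS]big_mkcond; apply: eq_bigr => j _; case: (j \in _).
  by field.
move=> j _; rewrite mxE; have [->|_] := eqVneq j i; first by rewrite active_id /=; field.
by case: (j \in _) => /=; field.
Qed.

(** With coordinate 0 included, v_p has exactly p^2 entries 1/p; this dictates the block size p^2 -
    1. *)
Lemma edot_kz_vec i : edot (kz_vec i) (kz_vec i) = 1.
Proof.
rewrite edot_sqr /kz_vec; case: ifP => [_|/negbT].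
  rewrite (bigD1 i) //= mxE !eqxx /= expr1n big1 ?addr0 // => j ji.
  by rewrite mxE (negbTE ji) andbF expr0n.
rewrite negb_or => /andP[i0 _]; rewrite (bigD1 ord0) //= [X in _ + X](_ : _ = 1 - (q i)%:R ^- 2).
  by rewrite mxE eqxx /= div1r exprVn addrC subrK.
rewrite -sum_block // big_mkcond [RHS]big_mkcond; apply: eq_bigr => j _; rewrite mxE.
have [->|j0] := eqVneq j ord0; first by rewrite q0 eq_sym q_eq1 (negbTE i0).
by case: eqP => _; rewrite ?mul0r ?expr0n // div1r exprVn.
Qed.

Lemma blattice_comb (b : seq 'rV[R]_n.+1) x :
  (forall y, y \in b -> blattice y) -> inIntSpan (in_tuple b) x -> blattice x.
Proof.
move=> Lb [a ->] j; rewrite phi_coord linear_sum rpred_sum // => i _.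
rewrite raddfMz rpredMz //=; have := Lb _ (mem_nth 0 (ltn_ord i)) j; by rewrite phi_coord.
Qed.

(** Freeness follows by counting dimensions, since a generating family spans the whole space. *)
Lemma blattice_basis (b : seq 'rV[R]_n.+1) : size b = n.+1 ->
  (forall y, y \in b -> blattice y) ->
  (forall x, blattice x -> inIntSpan (in_tuple b) x) -> is_basis blattice b.
Proof.
move=> sb Lb bL; split=> //.
  have : (fullv <= <<b>>)%VS.
    rewrite -span_kz_seq; apply/span_subvP => _ /tnthP[i ->]; rewrite tnth_mktuple.
    have [a ->] := bL _ (blattice_kz_vec i).
    by apply: rpred_sum => k _; rewrite rpredMz // memv_span // mem_nth.
  move/dimvS; rewrite dim_rV => dimb.
  by rewrite /free eqn_leq dim_span sb.
by apply/seteqP; split=> x; [exact: blattice_comb|exact: bL].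
Qed.

Lemma kz_seq_basis : is_basis blattice kz_seq.
Proof.
apply: blattice_basis => [|y|x Lx]; first by rewrite size_tuple.
  by move=> /tnthP[i ->]; rewrite tnth_mktuple; exact: blattice_kz_vec.
(* The values are already integers, so [Num.floor] only changes their type; [inord] converts the
   index type. *)
exists [ffun i : 'I_(size kz_seq) => Num.floor (phi (inord i) x)].
rewrite [LHS]kz_vec_decomp; pose F (i : nat) := kz_seq`_i *~ Num.floor (phi (inord i) x).
transitivity (\sum_(i < size kz_seq) F i); last by apply: eq_bigr => i _; rewrite ffunE.
rewrite size_tuple; apply: eq_bigr => i _.
by rewrite /F inord_val nth_kz_seq -scaler_int floorK ?Lx.
Qed.

Lemma enorm_kz_vec i : enorm (kz_vec i) = 1.
Proof. by rewrite /enorm edot_kz_vec sqrtr1. Qed.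

Lemma enorm_ge1 x : blattice x -> x != 0 -> 1 <= enorm x.
Proof.
by move=> Lx x0; rewrite -sqrtr1 ler_wsqrtr // edot_ge1.
Qed.

Lemma perp_proj0 (x : 'rV[R]_n.+1) : perp_proj 0%VS x = x.
Proof.
apply/esym/perp_projP; split=> [|u]; first by rewrite subrr mem0v.
by rewrite memv0 => /eqP->; rewrite linear0r.
Qed.

(** Norm 1 is minimal among nonzero lattice vectors, so the tie-break by length is automatic. Only
    the projected lengths need comparing. *)
Lemma kz_seq_korkin_zolotarev : is_korkin_zolotarev_basis blattice kz_seq.
Proof.
split=> [|i]; first exact: kz_seq_basis.
rewrite size_tuple => ilt /=; rewrite -[i]/(val (Ordinal ilt)).
move: (Ordinal ilt) => {ilt}i; rewrite nth_kz_seq; set U := <<_>>%VS.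
have uU : kz_vec i \notin U.
  apply/mem_span_take => /(_ i (leqnn _)) /eqP.
  by rewrite phi_kz_vec eqxx oner_eq0.
have yN0 y : y \notin U -> y != 0 by apply: contraNneq => ->; rewrite mem0v.
split=> [|y [[Ly /yN0 y0] _]]; last by rewrite enorm_kz_vec enorm_ge1.
split=> [|y [Ly yU]]; first by split=> //; exact: blattice_kz_vec.
have [i0|i0] := eqVneq i ord0.
  have -> : U = 0%VS by rewrite /U i0 /= take0 span_nil.
  by rewrite !perp_proj0 enorm_kz_vec enorm_ge1 ?yN0.
apply: ler_wsqrtr; apply: (@le_trans _ _ (kappa i)).
  by have [z zU <-] := kz_vec_kappa i0; exact: edot_perp_proj_le.
by apply: (kappa_le_edot i0 Ly yU); have [] := (perp_projP U y _).1 erefl.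
Qed.

(** * Discreteness and rank *)

Lemma blattice_is_lattice : is_lattice blattice.
Proof.
split=> [||x Lx]; [|exact: blatticeB|].
  by apply: blattice_int => j; rewrite mxE rpred0.
split; first exact/mem_set.
(* In a sup-norm ball of this radius, n+1 squares of size at most [e] sum to less than 1, the
   minimal squared norm. *)
pose e : R := n.+2%:R^-1; have e0 : 0 < e by rewrite invr_gt0 ltr0n.
exists (ball x e); first exact: nbhsx_ballx.
apply/seteqP; split=> y /=; last by move=> ->; split=> //; exact: ballxx.
move=> [xy Ly]; apply/eqP; rewrite -subr_eq0; apply: contraTT isT => yx.
have := edot_ge1 (blatticeB Ly Lx) yx; rewrite leNgt => /negP[].
have ye j : `|(y - x) 0 j| <= e.
  by rewrite !mxE distrC ltW //; exact: xy.2.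
apply: (@le_lt_trans _ _ (\sum_(j < n.+1) e)); last first.
  by rewrite sumr_const card_ord -[ltLHS]mulr_natr mulrC ltr_pdivrMr ?ltr0n // mul1r ltr_nat.
rewrite edot_sqr; apply: ler_sum => j _; rewrite -real_normK ?num_real //.
apply: le_trans (ye j); rewrite expr2 ler_piMl ?normr_ge0 // (le_trans (ye j)) //.
by rewrite invf_le1 ?ltr0n // ler1n.
Qed.

Lemma blattice_rank : has_rank blattice n.+1.
Proof.
exists fullv; split; last exact: dim_rV.
split=> [x _|W LW]; first exact: memvf.
rewrite -span_kz_seq; apply/span_subvP => _ /tnthP[i ->]; rewrite tnth_mktuple.
exact/LW/blattice_kz_vec.
Qed.

(** * The Minkowski basis *)

Definition unit_seq : seq 'rV[R]_n.+1 := [seq delta_mx 0 (lift ord0 i) | i : 'I_n <- enum 'I_n].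

Lemma size_unit_seq : size unit_seq = n.
Proof. by rewrite size_map size_enum_ord. Qed.

Lemma nth_unit_seq (i : 'I_n) : unit_seq`_i = delta_mx 0 (lift ord0 i).
Proof. by rewrite (nth_map i) ?size_enum_ord // nth_ord_enum. Qed.

Lemma mem_unit_seq y : y \in unit_seq -> exists i, y = delta_mx 0 i.
Proof. by move=> /mapP[i _ ->]; exists (lift ord0 i). Qed.

Lemma blattice_delta i : blattice (delta_mx 0 i).
Proof. by apply: blattice_int => j; rewrite mxE natr_int. Qed.

Lemma enorm_delta i : enorm (delta_mx 0 i : 'rV[R]_n.+1) = 1.
Proof.
rewrite /enorm edot_sqr (bigD1 i) //= mxE !eqxx expr1n big1 ?addr0 ?sqrtr1 // => j ji.
by rewrite mxE (negbTE ji) andbF expr0n.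
Qed.

(** A common denominator of the coordinates of all lattice vectors; it turns minimizations over the
    lattice into minimizations over natural numbers. *)
Definition denom : nat := \prod_(a | leading a) q a.

Lemma denom_gt0 : (0 < denom)%N.
Proof. by apply: prodn_gt0 => a; exact: q_gt0. Qed.

Lemma denom_int x j : blattice x -> denom%:R * x 0 j \is a Num.int.
Proof.
move=> Lx; have Pi i : i != ord0 -> denom%:R * x 0 i \is a Num.int.
  move=> i0; rewrite /denom (bigD1 (leader i)) /leading ?leader_eq0 ?i0 ?leaderK //= q_leader.
  by rewrite mulnC natrM -mulrA rpredM ?natr_int ?blattice_q.
have [->|/Pi//] := eqVneq j ord0.
rewrite -[x 0 ord0](subrK (\sum_(a | leading a) x 0 a)) mulrDr; apply: rpredD.
  by rewrite rpredM ?natr_int //; have := Lx ord0; rewrite /phi eqxx.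
by rewrite mulr_sumr; apply: rpred_sum => a /andP[a0 _]; exact: Pi.
Qed.

Lemma blattice_mulz x (k : int) : blattice x -> blattice (x *~ k).
Proof. by move=> Lx j; rewrite phi_coord raddfMz rpredMz //= -phi_coord. Qed.

Lemma unit_seq_completion : exists x, is_basis blattice (rcons unit_seq x).
Proof.
(* Any vector whose coordinate 0 is minimal among the positive ones works, by
   Euclidean division. *)
have ex : exists m, `[< (0 < m)%N /\ exists2 x, blattice x & denom%:R * x 0 ord0 = m%:R >].
  exists denom; apply/asboolP; split; first exact: denom_gt0.
  by exists (delta_mx 0 ord0); [exact: blattice_delta|rewrite mxE !eqxx mulr1].
have [m /asboolP[m0 [x Lx xm]] mmin] := ex_minnP ex.
exists x; apply: blattice_basis => [|y|y Ly]; first by rewrite size_rcons size_unit_seq.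
  by rewrite mem_rcons inE => /predU1P[->//|/mem_unit_seq[i ->]]; exact: blattice_delta.
have /intrP[z yz] := denom_int ord0 Ly.
pose k := (z %/ m)%Z; pose w := y - x *~ k.
have Lw : blattice w by apply: blatticeB => //; exact: blattice_mulz.
have w0 : w 0 ord0 = 0.
  have zm : denom%:R * w 0 ord0 = (z %% m)%Z%:~R.
    rewrite /w -scaler_int !mxE mulrBr yz mulrCA xm /modz rmorphB rmorphM /=.
    by rewrite pmulrn.
  have : (0 <= z %% m)%Z by rewrite modz_ge0 // -lt0n.
  have : (z %% m < m)%Z by rewrite ltz_pmod.
  case: (z %% m)%Z zm => // r zr rm _.
  apply/eqP; rewrite -(mulrI_eq0 _ (lregP (_ : denom%:R != 0))) ?pnatr_eq0 -?lt0n ?denom_gt0 //.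
  rewrite zr; case: (posnP r) => [->//|r0]; have : (m <= r)%N.
    by apply: mmin; apply/asboolP; split=> //; exists w.
  by rewrite leqNgt -ltz_nat rm.
(* With coordinate 0 gone, the remainder is integral and hence a combination of [unit_seq]. *)
have wZ j : w 0 j \is a Num.int by apply: blattice_coord0_int => //; rewrite w0 rpred0.
pose c (i : nat) := if (i < n)%N then Num.floor (w 0 (inord i.+1)) else k.
exists [ffun i : 'I_(size (rcons unit_seq x)) => c i].
pose F (i : nat) := (rcons unit_seq x)`_i *~ c i.
transitivity (\sum_(i < size (rcons unit_seq x)) F i); last by apply: eq_bigr => i _; rewrite ffunE.
rewrite size_rcons size_unit_seq big_ord_recr /= /F {2}/c ltnn nth_rcons size_unit_seq ltnn eqxx.
rewrite -[LHS](subrK (x *~ k)) -/w; congr (_ + _); clearbody w.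
apply/rowP => j; rewrite summxE.
under eq_bigr => i _ do
  rewrite nth_rcons size_unit_seq ltn_ord nth_unit_seq /c ltn_ord -scaler_int floorK ?wZ // !mxE /=.
case: (unliftP ord0 j) => [j' ->|->].
  rewrite (bigD1 j') //= eqxx mulr1 big1 ?addr0 => [|i ij].
    have -> : inord j'.+1 = lift ord0 j'; last by [].
    by apply: ord_inj; rewrite inordK // ltnS.
  by rewrite (inj_eq lift_inj) eq_sym (negbTE ij) mulr0.
by rewrite w0 big1 // => i _; rewrite (negbTE (neq_lift _ _)) mulr0.
Qed.

(** If [x] were integral at a leader [a], all lattice vectors would be, but [kz_vec a] has entry 1/p
    there. So every block of [x] is nonintegral and contributes at least 3/4. *)
Lemma completion_edot x : is_basis blattice (rcons unit_seq x) ->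
  3 / 4 * #|leading|%:R <= edot x x.
Proof.
move=> [_ Lb bL].
have Lx : blattice x by apply: Lb; rewrite mem_rcons mem_head.
have xa a : leading a -> x 0 a \isn't a Num.int.
  move=> ha; have /andP[a0 /eqP hda] := ha; apply/negP => xZ.
  have : kz_vec a 0 a \is a Num.int.
    have : blattice (kz_vec a) by exact: blattice_kz_vec.
    rewrite -bL => -[c ->]; rewrite summxE rpred_sum // => i _.
    rewrite -scaler_int mxE rpredM ?intr_int //.
    have := mem_nth 0 (ltn_ord i); rewrite {1}/in_tuple /= mem_rcons inE.
    by move=> /predU1P[->//|/mem_unit_seq[k ->]]; rewrite mxE natr_int.
  rewrite /kz_vec (negbTE a0) hda eqxx /= mxE eqxx orbT div1r => /norm_intr_ge1.
  rewrite invr_eq0 qR_neq0 ger0_norm ?invr_ge0 // => /(_ isT).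
  by rewrite invf_ge1 ?ltr0n ?q_gt0 // lern1 leqNgt q_gt1.
rewrite edot_blocks -[leLHS]add0r lerD ?sqr_ge0 //.
rewrite mulr_natr -sumr_const; apply: ler_sum => a ha.
have a0 : a != ord0 by case/andP: (ha).
apply: le_trans (block_nonint Lx a0 (xa a ha)).
by have := qV2_le4 a0; lra.
Qed.

Lemma blattice_min (A : set 'rV[R]_n.+1) x0 : A `<=` blattice -> A x0 ->
  exists2 x, A x & forall y, A y -> enorm x <= enorm y.
Proof.
move=> AL Ax0.
(* Squared norms have the common denominator [denom ^ 2]. *)
have nat_norm x : A x -> exists m, denom%:R ^+ 2 * edot x x = m%:R.
  move=> /AL Lx; apply/natrP; rewrite edot_sqr mulr_sumr rpred_sum // => j _.
  by rewrite -exprMn natr_exp_even ?denom_int.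
have ex : exists m, `[< exists2 x, A x & denom%:R ^+ 2 * edot x x = m%:R >].
  by have [m mE] := nat_norm _ Ax0; exists m; apply/asboolP; exists x0.
have [m /asboolP[x Ax xm] mmin] := ex_minnP ex.
exists x => // y Ay; apply: ler_wsqrtr.
have d2 : (0 : R) < denom%:R ^+ 2 by rewrite exprn_gt0 ?ltr0n ?denom_gt0.
have [k yk] := nat_norm _ Ay.
rewrite -(ler_pM2l d2) xm yk ler_nat; apply: mmin; apply/asboolP.
by exists y.
Qed.

(** The unit vectors are shortest among all nonzero lattice vectors, so only the last vector
    requires a minimization. *)
Lemma blattice_minkowski : exists v : n.+1.-tuple 'rV[R]_n.+1,
  is_minkowski_basis blattice v /\ 3 / 4 * #|leading|%:R <= enorm v`_n ^+ 2.
Proof.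
pose A := [set x | blattice x /\ is_primitive blattice (rcons unit_seq x)].
have [x1 x1b] := unit_seq_completion.
have Ax1 : A x1.
  split; last by exists [::]; rewrite cats0.
  by case: x1b => _ Lb _; apply: Lb; rewrite mem_rcons mem_head.
have [x [Lx [t xt]] xmin] := blattice_min (fun y (Ay : A y) => Ay.1) Ax1.
have {xt}xb : is_basis blattice (rcons unit_seq x).
  (* A free family in dimension n+1 leaves no room for vectors after [x]. *)
  have [fr _ _] := xt; suff t0 : t = [::] by move: xt; rewrite t0 cats0.
  apply/nilP; have := dimvS (subvf <<rcons unit_seq x ++ t>>%VS).
  by rewrite (eqP fr) dim_rV size_cat size_rcons size_unit_seq -[leqRHS]addn0 leq_add2l leqn0.
have sv : size (rcons unit_seq x) == n.+1 by rewrite size_rcons size_unit_seq.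
exists (Tuple sv); split; last first.
  rewrite /= nth_rcons size_unit_seq ltnn eqxx sqr_sqrtr; first exact: completion_edot.
  by rewrite edot_sqr sumr_ge0 // => j _; rewrite sqr_ge0.
split=> //= i; rewrite (eqP sv) ltnS leq_eqVlt => /predU1P[->|ilt].
  have -> : take n (rcons unit_seq x) = unit_seq by rewrite -cats1 take_size_cat ?size_unit_seq.
  rewrite nth_rcons size_unit_seq ltnn eqxx; split; last exact: xmin.
  by split=> //; exists [::]; rewrite cats0.
have vi : (rcons unit_seq x)`_i = delta_mx 0 (lift ord0 (Ordinal ilt)).
  by rewrite nth_rcons size_unit_seq ilt -[i]/(val (Ordinal ilt)) nth_unit_seq.
split.
  split; first by rewrite vi; exact: blattice_delta.
  exists (drop i.+1 (rcons unit_seq x)); rewrite -take_nth ?cat_take_drop //.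
  by rewrite (eqP sv) ltnS ltnW.
move=> y [Ly [s [fr _ _]]]; rewrite vi enorm_delta enorm_ge1 //.
apply: contraTneq fr => ->.
by apply/negP => /free_not0 -/(_ 0); rewrite mem_cat mem_rcons mem_head => /(_ isT); rewrite eqxx.
Qed.

End BlockLattice.

(** * The list of block labels *)

Definition blocks (ps : seq nat) : seq nat := flatten [seq nseq (p ^ 2).-1 p | p <- ps].

Lemma mem_blocks ps p : p \in blocks ps -> p \in ps.
Proof.
by move=> /flattenP[_ /mapP[r rps ->]]; rewrite mem_nseq => /andP[_ /eqP->].
Qed.

Lemma sorted_blocks ps : sorted leq ps -> sorted leq (blocks ps).
Proof.
rewrite !sorted_pairwise; try exact: leq_trans.
elim: ps => //= p ps IH /andP[/allP ple /IH spw].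
rewrite /blocks /= pairwise_cat spw andbT; apply/andP; split.
  by apply/allrelP => a b; rewrite mem_nseq => /andP[_ /eqP->] /mem_blocks; exact: ple.
rewrite -sorted_pairwise; last exact: leq_trans.
by elim: _.-1 => //= k; case: k => //= k ->; rewrite leqnn.
Qed.

Lemma count_blocks ps p : uniq ps -> p \in ps -> count_mem p (blocks ps) = (p ^ 2).-1.
Proof.
elim: ps => //= r ps IH /andP[rps ups]; rewrite inE /blocks /= count_cat count_nseq /=.
case: eqVneq => [->|pr] /= p_ps.
  rewrite mul1n -[RHS]addn0; congr addn; apply/count_memPn.
  by apply: contra rps; exact: mem_blocks.
by rewrite mul0n; exact: IH.
Qed.

Lemma size_blocks ps X : {in ps, forall p, p <= X}%N ->
  (size (blocks ps) <= size ps * (X ^ 2).-1)%N.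
Proof.
elim: ps => //= p ps IH pX; rewrite /blocks /= size_cat size_nseq mulSn leq_add //.
  by rewrite -!subn1 leq_sub2r // leq_exp2r // pX // mem_head.
by apply: IH => r rps; apply: pX; rewrite inE rps orbT.
Qed.

Lemma card_nth_eq (s : seq nat) n (v : nat) : size s = n ->
  #|[pred j : 'I_n | nth 0 s j == v]| = count_mem v s.
Proof.
move=> <-; rewrite -sum1_card -sum1_count (big_nth 0%N) big_mkord.
by apply: eq_bigl => j.
Qed.

(** * The rank compared with the number of blocks *)

Section Instance.
Variables (R : realType) (X : nat).
Hypothesis X_prime : prime X.

Let ps := primes_upto X.
Let n := size (blocks ps).
Let q (i : 'I_n.+1) : nat := nth 0%N (1%N :: blocks ps) i.

Let ps_prime p : p \in ps -> prime p.
Proof. by rewrite mem_primes_upto => /andP[]. Qed.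

Let X_ps : X \in ps. Proof. by rewrite mem_primes_upto X_prime leqnn. Qed.

Let uniq_ps : uniq ps. Proof. by rewrite filter_uniq // iota_uniq. Qed.

Let q_mem i : i != ord0 -> q i \in ps.
Proof.
case: i => -[//|i] ilt _; apply: mem_blocks; rewrite /q /= mem_nth //.
Qed.

Let q_prime i : i != ord0 -> prime (q i).
Proof. by move=> /q_mem/ps_prime. Qed.

Let q_mono (i j : 'I_n.+1) : (i <= j)%N -> (q i <= q j)%N.
Proof.
move=> ij; apply: (sorted_leq_nth leq_trans leqnn) => //; last 2 first.
- exact: ltn_ord.
- exact: ltn_ord.
have sb : sorted leq (blocks ps).
  by apply: sorted_blocks; apply: sorted_filter; [exact: leq_trans|exact: iota_sorted].
case E : (blocks ps) sb => [//|p s] /= ->; rewrite andbT.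
have : p \in ps by apply: mem_blocks; rewrite E mem_head.
by move=> /ps_prime/prime_gt0.
Qed.

Let q_card i : i != ord0 -> #|[pred j | q j == q i]| = (q i ^ 2).-1.
Proof.
move=> i0; rewrite card_nth_eq //= count_blocks ?q_mem //.
by rewrite eq_sym (gtn_eqF (prime_gt1 (q_prime i0))) add0n.
Qed.

Let leading_ge : (size ps <= #|leading q|)%N.
Proof.
rewrite cardE -(size_map q); apply: uniq_leq_size => // p pps.
have p1 := prime_gt1 (ps_prime pps).
have : p \in 1%N :: blocks ps.
  rewrite inE; apply/orP; right; rewrite -has_pred1 has_count count_blocks //.
  by rewrite -subn1 subn_gt0; nia.
move=> /(nthP 0%N)[k klt kp]; pose i : 'I_n.+1 := Ordinal klt.
have qi : q i = p by [].
have i0 : i != ord0 by apply: contraTneq p1; rewrite -qi => ->.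
apply/mapP; exists (leader q i); last by rewrite q_leader.
by rewrite mem_enum; apply/andP; rewrite leader_eq0 ?leaderK ?i0 ?eqxx.
Qed.

Let X_gt1 : (1 < X)%N. Proof. exact: prime_gt1. Qed.

(** The block of the prime [X] alone is this large; hence the ranks are unbounded. *)
Let X_le : (X <= n.+1)%N.
Proof.
apply: (@leq_trans (count_mem X (blocks ps)).+1); last by rewrite ltnS count_size.
by rewrite count_blocks //; nia.
Qed.

Let n_le : (n.+1 <= size ps * X ^ 2)%N.
Proof.
have s1 : (0 < size ps)%N by case: ps X_ps.
have : (n <= size ps * (X ^ 2).-1)%N.
  by apply: size_blocks => p; rewrite mem_primes_upto => /andP[].
by have : (0 < X ^ 2)%N; [rewrite expn_gt0; lia|nia].
Qed.

Let s : R := (size ps)%:R.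
(** The 3 comes from X <= 3 floor(X/2) for X >= 2, and [ln 2] from the logarithm of
    [chebyshev_lower]. *)
Let K : R := 3 / ln 2.

Let X_chebyshev : X%:R <= K * (s * ln X%:R).
Proof.
have l2 : 0 < ln 2 :> R by rewrite ln_gt0 // ltr1n.
have h : X./2%:R * ln 2 <= s * ln X%:R :> R.
  rewrite !mulr_natl -!lnXn ?ltr0n //; last by lia.
  rewrite ler_ln ?posrE ?exprn_gt0 ?ltr0n //; last by lia.
  by rewrite -!natrX ler_nat chebyshev_lower.
have X3 : X%:R <= 3 * X./2%:R :> R by rewrite -natrM ler_nat; lia.
rewrite /K mulrAC ler_pdivlMr //; apply: (@le_trans _ _ (3 * X./2%:R * ln 2)).
  by rewrite ler_pM2r.
by rewrite -mulrA ler_pM2l // ltr0n.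
Qed.

(** Chebyshev's bound and ln X <= ln N, inserted into N <= s X^2 for the rank N, bound N by a cubic
    in s; hence the exponent 1/3. *)
Let ln_bound : (n.+1)%:R <= K ^+ 2 * s ^+ 3 * ln (n.+1)%:R ^+ 2 :> R.
Proof.
have l2 : 0 < ln 2 :> R by rewrite ln_gt0 // ltr1n.
have K0 : 0 <= K by rewrite divr_ge0 // ltW.
have s0 : 0 <= s by rewrite ler0n.
have lX : ln X%:R <= ln (n.+1)%:R :> R.
  by rewrite ler_ln ?posrE ?ltr0n ?ler_nat //; lia.
have lX0 : 0 <= ln X%:R :> R by rewrite ln_ge0 // ler1n; lia.
apply: (@le_trans _ _ (s * X%:R ^+ 2)); first by rewrite -natrX -natrM ler_nat.
apply: (@le_trans _ _ (s * (K * (s * ln (n.+1)%:R)) ^+ 2)); last first.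
  by rewrite le_eqVlt; apply/orP; left; apply/eqP; ring.
have KL : 0 <= K * (s * ln (n.+1)%:R) by exact/(mulr_ge0 K0)/(mulr_ge0 s0)/(le_trans lX0).
rewrite ler_wpM2l // lerXn2r ?nnegrE //.
by apply: le_trans X_chebyshev _; rewrite (ler_wpM2l K0) // ler_wpM2l.
Qed.

Let powR_bound :
  (n.+1)%:R `^ (1 / 3) <= (K ^+ 2) `^ (1 / 3) * s * ln (n.+1)%:R `^ (2 / 3) :> R.
Proof.
have l0 : 0 <= ln (n.+1)%:R :> R by rewrite ln_ge0 // ler1n.
have s0 : 0 <= s by rewrite ler0n.
have K0 : 0 <= K by rewrite divr_ge0 // ln_ge0 // ler1n.
have K2 : 0 <= K ^+ 2 by rewrite exprn_ge0.
have s3 : 0 <= s ^+ 3 by rewrite exprn_ge0.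
have l2 : 0 <= ln (n.+1)%:R ^+ 2 :> R by rewrite exprn_ge0.
have Ks : 0 <= K ^+ 2 * s ^+ 3 by exact: mulr_ge0.
apply: (@le_trans _ _ ((K ^+ 2 * s ^+ 3 * ln (n.+1)%:R ^+ 2) `^ (1 / 3))).
  by rewrite ge0_ler_powR ?nnegrE ?ln_bound ?(mulr_ge0 Ks).
rewrite (powRM _ Ks l2) (powRM _ K2 s3) -(powR_mulrn 3 s0) -(powR_mulrn 2 l0) -!powRrM.
rewrite (_ : 3 * (1 / 3) = 1 :> R); last by field.
by rewrite (_ : 2 * (1 / 3) = 2 / 3 :> R) ?powRr1 //; field.
Qed.

Lemma blattice_instance : exists N, (X <= N)%N /\
  exists (L : set 'rV[R]_N) (v u : N.-tuple 'rV[R]_N),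
  [/\ is_lattice L /\ has_rank L N, is_minkowski_basis L v,
      is_korkin_zolotarev_basis L u &
      enorm v`_N.-1 ^+ 2 >=
        3 / 4 / (K ^+ 2) `^ (1 / 3) * N%:R `^ (1 / 3) / ln N%:R `^ (2 / 3) *
        \big[Order.max/0]_(x <- u) enorm x ^+ 2].
Proof.
have q0 : q ord0 = 1%N by [].
exists n.+1; split; first exact: X_le.
have [v [v_mink v_ge]] := blattice_minkowski R q0 q_prime q_card.
exists (@blattice R n q), v, (kz_seq R q); split.
- by split; [exact: blattice_is_lattice|exact: blattice_rank].
- exact: v_mink.
- exact: kz_seq_korkin_zolotarev.
have l0 : 0 < ln (n.+1)%:R :> R by rewrite ln_gt0 // ltr1n; lia.
have K0 : 0 < K by rewrite divr_gt0 ?ln_gt0 ?ltr1n.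
have k0 : 0 < (K ^+ 2) `^ (1 / 3) by rewrite powR_gt0 // exprn_gt0.
apply: le_trans v_ge; apply: (@le_trans _ _ (3 / 4 * s)); last first.
  by rewrite ler_pM2l ?divr_gt0 // ler_nat; exact: leading_ge.
have max1 : \big[Order.max/0]_(x <- kz_seq R q) enorm x ^+ 2 <= 1 :> R.
  rewrite big_seq; elim/big_ind: _ => [|a b a1 b1|x]; first exact: ler01.
    by rewrite ge_max a1 b1.
  by move=> /tnthP[i ->]; rewrite tnth_mktuple enorm_kz_vec // expr1n.
apply: le_trans (ler_wpM2l _ max1) _.
  by rewrite !mulr_ge0 ?invr_ge0 ?powR_ge0 // ltW.
rewrite mulr1 ler_pdivrMr ?powR_gt0 // mulrAC ler_pdivrMr //.
rewrite [leRHS](_ : _ = 3 / 4 * ((K ^+ 2) `^ (1 / 3) * s * ln (n.+1)%:R `^ (2 / 3))).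
  by rewrite ler_pM2l ?divr_gt0 ?powR_bound.
by ring.
Qed.

End Instance.

(** * The sequence of lattices *)

Theorem theorem1p4 (R : realType) :
  exists c : R, 0 < c /\
  exists (a m : nat -> nat) (L : forall i, set 'rV[R]_(m i))
         (v u : forall i, (a i).-tuple 'rV[R]_(m i)),
    [/\ {homo a : i j / (i < j)%N},
        a @ \oo --> \oo &
        forall i,
          [/\ (1 < a i)%N,
              is_lattice (L i) /\ has_rank (L i) (a i),
              is_minkowski_basis (L i) (v i),
              is_korkin_zolotarev_basis (L i) (u i) &
              enorm (v i)`_(a i).-1 ^+ 2 >=
                c * (a i)%:R `^ (1 / 3) / ln (a i)%:R `^ (2 / 3) *
                \big[Order.max/0]_(x <- u i) enorm x ^+ 2]].
Proof.
pose c : R := 3 / 4 / ((3 / ln 2) ^+ 2) `^ (1 / 3).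
exists c; split.
  by rewrite divr_gt0 ?divr_gt0 ?powR_gt0 ?exprn_gt0 // divr_gt0 ?ln_gt0 ?ltr1n.
pose good N (d : set 'rV[R]_N * N.-tuple 'rV[R]_N * N.-tuple 'rV[R]_N) :=
  [/\ is_lattice d.1.1 /\ has_rank d.1.1 N, is_minkowski_basis d.1.1 d.1.2,
      is_korkin_zolotarev_basis d.1.1 d.2 &
      enorm d.1.2`_N.-1 ^+ 2 >=
        c * N%:R `^ (1 / 3) / ln N%:R `^ (2 / 3) *
        \big[Order.max/0]_(x <- d.2) enorm x ^+ 2].
have /choice[f fP] : forall M : nat, exists N, (M < N)%N /\ exists d, @good N d.
  move=> M; have [X MX pX] := prime_above M.
  have [N [XN [L [v [u LP]]]]] := blattice_instance R pX.
  by exists N; split; [exact: leq_trans XN|exists (L, v, u)].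
(* Starting at [f 1] makes every rank a value of [f], so it carries a lattice, and keeps it above 1,
   where [ln] is positive. *)
pose a i := iter i.+1 f 1%N.
have a_lt i : (a i < a i.+1)%N by exact: (fP (a i)).1.
have a_homo : {homo a : i j / (i < j)%N} by apply: homo_ltn a_lt; exact: ltn_trans.
have a_good i : exists d, @good (a i) d by exact: (fP (iter i f 1%N)).2.
pose d i := projT1 (cid (a_good i)).
have dP i : good (a i) (d i) by exact: projT2 (cid (a_good i)).
exists a, a, (fun i => (d i).1.1), (fun i => (d i).1.2), (fun i => (d i).2).
have a_ge i : (i < a i)%N.
  by elim: i => [|i IH]; [exact: leq_trans (fP 1%N).1|exact: leq_ltn_trans IH (a_lt i)].
have a_gt1 i : (1 < a i)%N.
  case: i => [|i]; first exact: (fP 1%N).1.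
  exact: leq_ltn_trans (leq_ltn_trans (leq0n i) (a_ge i)) (a_lt i).
split=> //.
  apply/cvgnyPge => A; exists A => // i /= Ai.
  exact: leq_trans Ai (ltnW (a_ge i)).
by move=> i; have [? ? ? ?] := dP i.
Qed.
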